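(* Let $t<2$, $t\ne 0$, be a real number. For $a,b\in\mathbb{N}$ put $f(a,b)=\gcd(ab,a+b)/\gcd(a,b)$. Then for real $x>1$, $$\sum_{a,b\le x}(f(a,b))^t = x^2\prod_p\left(1+\frac{p(p^t-1)}{(p+1)(p^3-p^t)}\right)+E_t(x),$$ where $$E_t(x)\ll\begin{cases} x^{1+t/2}\log x, & \text{if } 0<t<2,\\ x(\log x)^3, & \text{if } t<0.\end{cases}$$
   Context: $\mathbb{N}=\{1,2,\ldots\}$; sums over $a,b\le x$ run over all ordered pairs $(a,b)\in\mathbb{N}^2$ with $a\le x$ and $b\le x$. The function $f$ takes positive integer values. $\prod_p$ is a product over all primes.
   Formalization: The bound on E_t(x) is stated for x ≥ x0 with a constant depending on t and on x0, for each x0 > 1, since no single constant works for all x > 1: as x → 1+, E_t(x) tends to a nonzero limit while log x → 0. *)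

(* Defs.v *)
From HB Require Import structures.
From mathcomp Require Import all_boot all_order all_algebra.
From mathcomp Require Import all_classical all_reals all_analysis.

Set Implicit Arguments.
Unset Strict Implicit.
Unset Printing Implicit Defensive.

Import Order.TTheory GRing.Theory Num.Theory.
Import numFieldNormedType.Exports.

Local Open Scope ring_scope.

(* Truncated division is exact here for all a, b: see [gcdn_dvd_gcdnMD]. *)
Definition gcd_ratio (a b : nat) : nat :=
  (gcdn (a * b) (a + b) %/ gcdn a b)%N.

Lemma gcdn_dvd_gcdnMD (a b : nat) : (gcdn a b %| gcdn (a * b) (a + b))%N.
Proof.
by rewrite dvdn_gcd dvdn_mulr ?dvdn_gcdl // dvdn_add ?dvdn_gcdl ?dvdn_gcdr.
Qed.

Lemma gcd_ratio_gt0 (a b : nat) : (0 < a)%N -> (0 < gcd_ratio a b)%N.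
Proof.
move=> a0; rewrite divn_gt0 ?gcdn_gt0 ?a0 //.
by apply: dvdn_leq (gcdn_dvd_gcdnMD a b); rewrite gcdn_gt0 addn_gt0 a0 orbT.
Qed.

Definition gcd_ratio_sum (R : realType) (t x : R) : R :=
  \sum_(1 <= a < (Num.truncn x).+1) \sum_(1 <= b < (Num.truncn x).+1)
    (gcd_ratio a b)%:R `^ t.

Definition euler_factor (R : realType) (t : R) (p : nat) : R :=
  1 + (p%:R * (p%:R `^ t - 1)) / ((p%:R + 1) * (p%:R ^+ 3 - p%:R `^ t)).

Definition prime_partial_prod (R : realType) (F : nat -> R) (n : nat) : R :=
  \prod_(0 <= p < n | prime p) F p.

(* [limn] is total, so this is the product over all primes only when the
   partial products converge. *)
Definition prime_prod (R : realType) (F : nat -> R) : R :=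
  limn (prime_partial_prod F).

(* E << g for x > 1, with an implied constant uniform on each [x0, +oo[ with
   x0 > 1. No constant serves on all of ]1, +oo[ when g contains a power of
   log x and E has a nonzero limit at 1, as is the case for the error term of
   [gcd_ratio_sum]: the sum is 1 for 1 <= x < 2, and the product differs
   from 1. *)
Definition vinogradov_gt1 (R : realType) (E g : R -> R) : Prop :=
  forall x0 : R, 1 < x0 ->
    exists C : R, forall x : R, x0 <= x -> `|E x| <= C * g x.

(* Main.v *)
(* Write a = g a', b = g b' with g = gcd(a, b); then f(a, b) = gcd(g, a' + b').
   Expand n^t as the sum over d | n of H(d), where
   H(d) = d^t prod_(p | d) (1 - p^-t). The pairs with d | f(a, b) are exactly
   a = d n u, b = d n v where all primes of n divide d, u is coprime to d, and
   d | u + v; moreover n is unique. Counting (u, v) up to z = x / (d n) gives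
   phi(d) z^2 / d^2 with an error at most 3 z and at most 6 z^2 / d. Summing over
   n, the number of pairs is x^2 c(d) up to O((x / d) (1 + log x)) and up to
   O(x^2 / d^3), with c(d) = phi(d) / d^4 prod_(p | d) (1 - p^-2)^-1. The first
   bound is used for d <= sqrt x and the second one for d > sqrt x, together
   with |H(d)| <= d^max(t, 0). The main term x^2 sum_d H(d) c(d) is turned into
   the Euler product by multiplicativity. *)
Require Import Defs.
From HB Require Import structures.
From mathcomp Require Import all_boot all_order all_algebra.
From mathcomp Require Import all_classical all_reals all_analysis.
From mathcomp Require Import zify ring lra.

Set Implicit Arguments.
Unset Strict Implicit.
Unset Printing Implicit Defensive.

Import Order.TTheory GRing.Theory Num.Theory.
Import numFieldNormedType.Exports.

Local Open Scope classical_set_scope.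
Local Open Scope ring_scope.

(** * Counting the pairs with a prescribed divisor *)

Section PairCount.
Local Open Scope nat_scope.

(** Dividing $\gcd(g^2ab, g(a+b))$ by $g$ leaves $\gcd(gab, a+b)$, and $ab$ is coprime to $a+b$. *)
Lemma gcd_ratioM g a b : 0 < g -> coprime a b ->
  gcd_ratio (g * a) (g * b) = gcdn g (a + b).
Proof.
move=> g0 cab; rewrite /gcd_ratio -muln_gcdr (eqP cab) muln1.
have -> : g * a * (g * b) = g * (g * (a * b)) by lia.
rewrite -mulnDr -muln_gcdr mulKn // mulnC.
rewrite [LHS]gcdnC Gauss_gcdr 1?gcdnC //.
have cD (m n : nat) : coprime m n -> coprime (m + n) m.
  by move=> cmn; rewrite coprime_sym /coprime gcdnDl.
by rewrite coprimeMr cD //= addnC cD // coprime_sym.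
Qed.

(* [n] collects the primes of [d] in [gcd a b / d]. *)
Lemma dvdn_gcd_ratio d n a b : 0 < a -> 0 < b -> 0 < d -> \pi(d).-nat n ->
  [&& d * n %| a, d * n %| b, coprime (a %/ (d * n)) d
    & d %| a %/ (d * n) + b %/ (d * n)] =
  (d %| gcd_ratio a b) && (n == (gcdn a b %/ d)`_(\pi(d))).
Proof.
move=> a0 b0 d0 dn.
have n0 : 0 < n by move/andP: dn => [].
have dn0 : 0 < d * n by rewrite muln_gt0 d0.
have g0 : 0 < gcdn a b by rewrite gcdn_gt0 a0.
apply/idP/idP => [/and4P[/dvdnP[u au] /dvdnP[v bv]]|/andP[df /eqP nE]].
  (* Here $\gcd(a,b) = dn\gcd(u,v)$ with $\gcd(u,v)$ prime to $d$, so $n$ is exactly the part of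
     $\gcd(a,b)/d$ made of primes of $d$. Cancelling $\gcd(u,v)$ in $u+v$ preserves divisibility by
     $d$. *)
  rewrite {}au {}bv in a0 b0 g0 *; rewrite !mulnK // => cud dvduv.
  have gE : gcdn (u * (d * n)) (v * (d * n)) = d * (n * gcdn u v).
    by rewrite -muln_gcdl mulnC mulnA.
  have [u0 v0] : 0 < u /\ 0 < v by split; case: (u) (v) a0 b0 => [|?] [|?].
  have m0 : 0 < gcdn u v by rewrite gcdn_gt0 u0.
  have cmd : coprime d (gcdn u v).
    by apply: coprime_dvdr (dvdn_gcdl u v) _; rewrite coprime_sym.
  rewrite gE mulKn // partnM // part_pnat_id //.
  rewrite part_p'nat ?muln1 ?eqxx ?andbT; last by rewrite -coprime_pi'.
  have [u' uE] := dvdnP (dvdn_gcdl u v); have [v' vE] := dvdnP (dvdn_gcdr u v).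
  have cuv : coprime u' v'.
    rewrite /coprime -(eqn_pmul2l m0) muln1 muln_gcdr ![gcdn u v * _]mulnC.
    by rewrite -uE -vE.
  have -> : u * (d * n) = (gcdn u v * (d * n)) * u' by rewrite {1}uE; lia.
  have -> : v * (d * n) = (gcdn u v * (d * n)) * v' by rewrite {1}vE; lia.
  rewrite gcd_ratioM ?muln_gt0 ?m0 ?d0 // dvdn_gcd.
  rewrite dvdn_mull ?dvdn_mulr //= -(Gauss_dvdl _ cmd) mulnDl.
  by rewrite -uE -vE.
(* Conversely, let $g = \gcd(a,b)$, $a = ga'$, $b = gb'$ and $g = dnm$ with $m$ prime to $d$. Then
   $u = ma'$, $v = mb'$, and $a'$ is prime to $d$ because it is prime to $a'+b'$. *)
have [a' aE] := dvdnP (dvdn_gcdl a b); have [b' bE] := dvdnP (dvdn_gcdr a b).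
have cab : coprime a' b'.
  rewrite /coprime -(eqn_pmul2l g0) muln1 muln_gcdr ![gcdn a b * _]mulnC.
  by rewrite -aE -bE.
move: (gcdn a b) aE bE g0 nE => g aE bE g0 nE; rewrite {}aE {}bE in df *.
move: df; rewrite !(mulnC _ g) gcd_ratioM // dvdn_gcd.
case/andP=> /dvdnP[k kE] dab.
have k0 : 0 < k by case: k kE g0 => [->|].
rewrite kE mulnK // in nE.
have kpart : k = n * k`_(\pi(d)^') by rewrite nE partnC.
set m := k`_(\pi(d)^') in kpart.
have m0 : 0 < m by rewrite part_gt0.
have cmd : coprime m d by rewrite coprime_sym coprime_pi' // part_pnat.
have -> : g * a' = m * a' * (d * n) by rewrite kE kpart; lia.
have -> : g * b' = m * b' * (d * n) by rewrite kE kpart; lia.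
rewrite !mulnK // !(dvdn_mull _ (dvdnn _)) //= -mulnDr dvdn_mull // andbT coprimeMl cmd /=.
have : coprime a' (a' + b') by rewrite /coprime gcdnDl.
by apply: coprime_dvdr.
Qed.

(** With $Z = \lfloor X/(dn) \rfloor$ these are the pairs $(u,v)$ of the overview. Coprimality to
    $d$ passes from $u$ to $v$ through $d \mid u+v$. *)
Definition coprime_pair_count d Z :=
  \sum_(1 <= u < Z.+1 | coprime u d) \sum_(1 <= v < Z.+1) (d %| u + v).

Lemma sum_nat_dvdn (F : nat -> nat) k X : 0 < k ->
  \sum_(1 <= a < X.+1 | k %| a) F (a %/ k) = \sum_(1 <= u < (X %/ k).+1) F u.
Proof.
move=> k0; elim: X => [|X IH]; first by rewrite div0n !big_geq.
rewrite big_mkcond big_nat_recr // -big_mkcond IH divnS //.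
case: ifP => kX /=; last by rewrite addn0 add0n.
by rewrite kX add1n [in RHS]big_nat_recr.
Qed.

(** By [dvdn_gcd_ratio], a pair with $d \mid f(a,b)$ is counted for exactly one $n$. After
    exchanging the sums, $a = dnu$ and $b = dnv$ turn the count for a fixed $n$ into a
    [coprime_pair_count]. *)
Lemma sum_dvdn_gcd_ratio d X : 0 < d ->
  \sum_(1 <= a < X.+1) \sum_(1 <= b < X.+1) (d %| gcd_ratio a b) =
  \sum_(1 <= n < X.+1 | \pi(d).-nat n) coprime_pair_count d (X %/ (d * n)).
Proof.
move=> d0.
pose Q n a b := coprime (a %/ (d * n)) d && (d %| a %/ (d * n) + b %/ (d * n)).
transitivity (\sum_(1 <= a < X.+1) \sum_(1 <= b < X.+1)
    \sum_(1 <= n < X.+1 | \pi(d).-nat n)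
      [&& d * n %| a, d * n %| b & Q n a b] : nat).
  apply: eq_big_nat => a /andP[a0 aX]; apply: eq_big_nat => b /andP[b0 bX].
  set n0 := (gcdn a b %/ d)`_(\pi(d)).
  transitivity (\sum_(1 <= n < X.+1 | \pi(d).-nat n)
      ((d %| gcd_ratio a b) && (n == n0)) : nat).
    case df: (d %| gcd_ratio a b); last by rewrite big1.
    rewrite big_mkcond (bigD1_seq n0) ?iota_uniq //=.
      by rewrite part_pnat eqxx big1 // => n /negPf->; rewrite if_same.
    rewrite mem_index_iota part_gt0 /= (leq_ltn_trans _ aX) //.
    (* The unique $n$ is in range because it is at most $\gcd(a,b) \le a$; if the quotient is $0$,
       its part is $1$ by convention. *)
    rewrite /n0; have [->|k0] := posnP (gcdn a b %/ d); first by rewrite partn0.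
    apply: leq_trans (dvdn_leq a0 (dvdn_gcdl a b)).
    by apply: leq_trans (leq_div _ d); exact: dvdn_leq (dvdn_part _ _).
  apply: eq_bigr => n dn; congr nat_of_bool.
  by rewrite -dvdn_gcd_ratio.
under eq_bigr do rewrite exchange_big /=.
rewrite exchange_big /=; apply: eq_bigr => n dn.
have dn0 : 0 < d * n by rewrite muln_gt0 d0; case/andP: dn.
rewrite /coprime_pair_count [RHS]big_mkcond -sum_nat_dvdn // [RHS]big_mkcond.
apply: eq_bigr => a _; case: (d * n %| a); last by rewrite big1.
under eq_bigr do rewrite andTb /Q.
case: (coprime _ _); last by rewrite big1 // => b _; rewrite andbF.
rewrite -sum_nat_dvdn // [RHS]big_mkcond; apply: eq_bigr => b _.
by case: (d * n %| b).
Qed.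

Lemma sum_period (P : nat -> nat) d m : (forall i, P (i + d) = P i) ->
  \sum_(m <= i < m + d) P i = \sum_(0 <= i < d) P i.
Proof.
move=> Pd; elim: m => [|m <-]; first by rewrite add0n.
have [->|d0] := posnP d; first by rewrite !addn0 !big_geq.
have md : m < m + d by lia.
by rewrite addSn big_nat_recr //= Pd [RHS]big_ltn // addnC.
Qed.

Lemma sum_periodM (P : nat -> nat) d m q : (forall i, P (i + d) = P i) ->
  \sum_(m <= i < m + q * d) P i = q * \sum_(0 <= i < d) P i.
Proof.
move=> Pd; elim: q => [|q IH]; first by rewrite mul0n addn0 big_geq.
rewrite (@big_cat_nat _ _ _ (m + q * d)) /=; [|lia|lia].
by rewrite IH mulSn -(sum_period (m + q * d) Pd) -addnA -mulSnr addnC.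
Qed.

Lemma sum_period_bounds (P : nat -> nat) d m Z : 0 < d ->
    (forall i, P (i + d) = P i) ->
  Z %/ d * \sum_(0 <= i < d) P i <= \sum_(m <= i < m + Z) P i
    <= (Z %/ d).+1 * \sum_(0 <= i < d) P i.
Proof.
move=> d0 Pd; rewrite -!(sum_periodM m _ Pd).
have Zq : Z %/ d * d <= Z < (Z %/ d).+1 * d by rewrite leq_trunc_div ltn_ceil.
move: Zq => /andP[q1 q2]; apply/andP; split.
  by rewrite [leqRHS](@big_cat_nat _ _ _ (m + Z %/ d * d)) /= ?leq_addr //; lia.
by rewrite [leqRHS](@big_cat_nat _ _ _ (m + Z)) /= ?leq_addr //; lia.
Qed.

Lemma count_dvdn_shift d u Z : 0 < d ->
  Z %/ d <= \sum_(1 <= v < Z.+1) (d %| u + v) <= (Z %/ d).+1.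
Proof.
move=> d0; have dper i : (d %| u + (i + d)) = (d %| u + i) :> nat.
  by rewrite addnA dvdn_addl.
have := sum_period_bounds 1 Z d0 dper.
rewrite -(sum_period 1 dper) add1n.
suff -> : \sum_(1 <= i < 1 + d) (d %| u + i) = 1 by rewrite !muln1.
have dper' i : (d %| i + d) = (d %| i) :> nat by rewrite dvdn_addl.
transitivity (\sum_(1 + u <= i < 1 + u + d) (d %| i) : nat).
  by rewrite big_addn addnAC addnK; under [RHS]eq_bigr do rewrite addnC.
rewrite sum_period // -(sum_period 1 dper') add1n -divn_count_dvd.
by rewrite divnn d0.
Qed.

(** Let $q = \lfloor Z/d \rfloor$. Each admissible $u$ has $q$ or $q+1$ partners $v$, and the number
    of admissible $u$ lies between $\varphi(d)q$ and $\varphi(d)(q+1)$. It is also at most $Z$,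
    which gives the useful upper bound when $q = 0$. *)
Lemma coprime_pair_count_bounds d Z : 0 < d ->
  totient d * (Z %/ d) ^ 2 <= coprime_pair_count d Z
    <= minn (totient d * (Z %/ d).+1 ^ 2) (Z * (Z %/ d).+1).
Proof.
move=> d0; have cper i : coprime d (i + d) = coprime d i :> nat.
  by rewrite /coprime gcdnDr.
have := sum_period_bounds 1 Z d0 cper; rewrite -totient_count_coprime add1n.
have -> : \sum_(1 <= i < Z.+1) coprime d i = \sum_(1 <= u < Z.+1 | coprime u d) 1.
  by rewrite [RHS]big_mkcond; apply: eq_bigr => i _; rewrite coprime_sym; case: ifP.
set U := bigop _ _ _ => /andP[U1 U2].
have UZ : U <= Z.
  rewrite -[leqRHS]subn0 -subSS -[leqRHS]muln1 -sum_nat_const_nat.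
  by rewrite /U big_mkcond leq_sum // => i _; case: ifP.
have M1 : U * (Z %/ d) <= coprime_pair_count d Z.
  rewrite /U big_distrl /=; apply: leq_sum => u _; rewrite mul1n.
  by case/andP: (count_dvdn_shift u Z d0).
have M2 : coprime_pair_count d Z <= U * (Z %/ d).+1.
  rewrite /U big_distrl /=; apply: leq_sum => u _; rewrite mul1n.
  by case/andP: (count_dvdn_shift u Z d0).
rewrite leq_min; apply/and3P; split.
- by apply: leq_trans M1; rewrite -mulnn mulnA leq_mul // mulnC.
- by apply: leq_trans M2 _; rewrite -mulnn mulnA leq_mul // mulnC.
- by apply: leq_trans M2 _; rewrite leq_mul.
Qed.

(** Since $0 < u+v \le 2Z < d$. This vanishing yields the error bound of order $z^2/d$ for small
    $z$. *)
Lemma coprime_pair_count_eq0 d Z : 2 * Z < d -> coprime_pair_count d Z = 0.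
Proof.
move=> Zd; rewrite /coprime_pair_count big_nat_cond big1 // => u /andP[uZ _].
rewrite big_nat_cond big1 // => v /andP[vZ _].
case: (boolP (d %| u + v)) => // /dvdn_leq; lia.
Qed.

End PairCount.

(** * Jordan's totient with a real exponent *)

(** The map $(d,e) \mapsto de$ is a bijection onto the divisors of $mn$: $d$ and $e$ are recovered
    as the gcds of $de$ with $m$ and $n$. *)
Lemma sum_divisors_coprime (V : nmodType) (F : nat -> V) m n : coprime m n ->
    (0 < m)%N -> (0 < n)%N ->
  \sum_(d <- divisors (m * n)) F d =
  \sum_(d <- divisors m) \sum_(e <- divisors n) F (d * e)%N.
Proof.
move=> cmn m0 n0; rewrite -big_allpairs_dep; apply: perm_big.
apply: uniq_perm; first exact: divisors_uniq.
  apply: allpairs_uniq; rewrite ?divisors_uniq //.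
  move=> _ _ /allpairsP[[d e] /= [dm en ->]] /allpairsP[[d' e'] /= [dm' en' ->]] /=.
  rewrite -!dvdn_divisors // in dm en dm' en' * => dede.
  have gE u v : (u %| m)%N -> (v %| n)%N -> gcdn m (u * v) = u.
    move=> um vn; rewrite Gauss_gcdl; first exact/gcdn_idPr.
    exact: coprime_dvdr vn cmn.
  have gE' u v : (u %| m)%N -> (v %| n)%N -> gcdn n (u * v) = v.
    move=> um vn; rewrite Gauss_gcdr; first exact/gcdn_idPr.
    by apply: coprime_dvdr um _; rewrite coprime_sym.
  by rewrite -(gE d e) // -{2}(gE' d e) // dede gE ?gE'.
move=> x; rewrite -dvdn_divisors ?muln_gt0 ?m0 //.
apply/idP/allpairsP => [xmn|[[d e] /= []]]; last first.
  by rewrite -!dvdn_divisors // => dm en ->; exact: dvdn_mul.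
exists (gcdn x m, (x %/ gcdn x m)%N).
rewrite /= -!dvdn_divisors // dvdn_gcdr [RHS]mulnC divnK ?dvdn_gcdl //; split => //.
have g0 : (0 < gcdn x m)%N by rewrite gcdn_gt0 m0 orbT.
have [x' xE] := dvdnP (dvdn_gcdl x m); have [m' mE] := dvdnP (dvdn_gcdr x m).
rewrite [X in (X %/ _)%N]xE mulnK //.
have cxm : coprime x' m'.
  rewrite /coprime -(eqn_pmul2l g0) muln1 muln_gcdr ![(gcdn x m * _)%N]mulnC.
  by rewrite -xE -mE.
rewrite -(Gauss_dvdr _ cxm) -(dvdn_pmul2l g0) mulnA ![(gcdn x m * _)%N]mulnC.
by rewrite -xE -mE.
Qed.

Lemma sum_divisorsX (V : nmodType) (F : nat -> V) p k : prime p ->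
  \sum_(d <- divisors (p ^ k)) F d = \sum_(0 <= i < k.+1) F (p ^ i)%N.
Proof.
move=> pp; rewrite -(big_map (expn p) xpredT).
apply: perm_big; apply: uniq_perm; rewrite ?divisors_uniq //.
  by rewrite map_inj_uniq ?iota_uniq //; apply: expnI; exact: prime_gt1.
move=> d; rewrite -dvdn_divisors ?expn_gt0 ?prime_gt0 //.
apply/dvdn_pfactor/mapP => // -[i ik ->]; exists i => //.
  by rewrite mem_index_iota.
by move: ik; rewrite mem_index_iota.
Qed.

Section Jordan.
Context {R : realType}.
Implicit Types t : R.

Lemma prod_primesM (F : nat -> R) m n : coprime m n -> (0 < m)%N -> (0 < n)%N ->
  \prod_(p <- primes (m * n)) F p =
  (\prod_(p <- primes m) F p) * \prod_(p <- primes n) F p.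
Proof.
move=> cmn m0 n0; rewrite -big_cat /=; apply: perm_big; apply: uniq_perm.
- exact: primes_uniq.
- by rewrite cat_uniq !primes_uniq -coprime_has_primes // cmn.
- by move=> p; rewrite mem_cat primesM.
Qed.

Lemma prod_primesX (F : nat -> R) p k : prime p ->
  \prod_(q <- primes (p ^ k.+1)) F q = F p.
Proof. by move=> pp; rewrite primesX // primes_prime // big_seq1. Qed.

(** The function $H$ of the overview, that is, the Dirichlet convolution of the Möbius function with
    $n \mapsto n^t$. *)
Definition jordan t n : R :=
  n%:R `^ t * \prod_(p <- primes n) (1 - p%:R `^ (- t)).

Lemma jordan1 t : jordan t 1 = 1.
Proof. by rewrite /jordan powR1 big_nil mulr1. Qed.

Lemma jordanM t m n : coprime m n -> (0 < m)%N -> (0 < n)%N ->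
  jordan t (m * n) = jordan t m * jordan t n.
Proof.
by move=> cmn m0 n0; rewrite /jordan prod_primesM // natrM powRM // mulrACA.
Qed.

Lemma powR_natX t n k : (n ^ k)%:R `^ t = (n%:R `^ t) ^+ k :> R.
Proof. by rewrite natrX -powR_mulrn ?ler0n // -powRrM mulrC powRrM powR_mulrn ?powR_ge0. Qed.

Lemma jordanX t p k : prime p ->
  jordan t (p ^ k.+1) = (p%:R `^ t) ^+ k.+1 - (p%:R `^ t) ^+ k.
Proof.
move=> pp; rewrite /jordan prod_primesX // powR_natX powRN mulrBr mulr1.
by rewrite exprSr mulfK // gt_eqF // powR_gt0 // ltr0n prime_gt0.
Qed.

(** Strong induction: split off the full power of the smallest prime factor, where the sum
    telescopes by [jordanX], and apply the hypothesis to the cofactor. *)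
Lemma sum_jordan t n : (0 < n)%N ->
  \sum_(d <- divisors n) jordan t d = n%:R `^ t.
Proof.
have [N] := ubnP n; elim: N n => // N IH n nN n0.
have [n1|n1] := leqP n 1.
  have -> : n = 1%N by lia.
  by rewrite big_seq1 jordan1 powR1.
have pp := pdiv_prime n1; set p := pdiv n in pp.
have k0 : (0 < logn p n)%N by rewrite logn_gt0 mem_primes pp n0 pdiv_dvd.
have := partnC p n0; rewrite p_part; set m := (n`_p^')%N => nE.
have m0 : (0 < m)%N by rewrite part_gt0.
have cpm : coprime (p ^ logn p n) m by rewrite -p_part coprime_partC.
have pk0 : (0 < p ^ logn p n)%N by rewrite expn_gt0 prime_gt0.
have mn : (m < n)%N.
  by rewrite -nE -[X in (X < _)%N]mul1n ltn_mul2r m0 /= -(expn0 p) ltn_exp2l ?prime_gt1.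
rewrite -{1}nE sum_divisors_coprime //.
transitivity (\sum_(d <- divisors (p ^ logn p n)) jordan t d * m%:R `^ t).
  rewrite big_seq [RHS]big_seq; apply: eq_bigr => d.
  rewrite -dvdn_divisors // => dp.
  rewrite -IH ?(leq_trans mn) // big_distrr /= big_seq [RHS]big_seq.
  apply: eq_bigr => e; rewrite -dvdn_divisors // => em.
  rewrite jordanM ?(dvdn_gt0 _ dp) ?(dvdn_gt0 _ em) //.
  exact: coprime_dvdl dp (coprime_dvdr em cpm).
rewrite -big_distrl /= -[in RHS]nE natrM powRM //; congr (_ * _).
rewrite sum_divisorsX // big_nat_recl // expn0 jordan1 powR_natX.
rewrite (eq_bigr (fun i => (p%:R `^ t) ^+ i.+1 - (p%:R `^ t) ^+ i)).
  by rewrite telescope_sumr // expr0; ring.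
by move=> i _; rewrite jordanX.
Qed.

(** For $t \ge 0$ every factor $1 - p^{-t}$ lies in $[0,1]$. For $t < 0$ its absolute value is at
    most $p^{-t}$, so the product is at most $\mathrm{rad}(n)^{-t} \le n^{-t}$, which cancels
    $n^t$. *)
Lemma jordan_bound t n : (0 < n)%N ->
  `|jordan t n| <= n%:R `^ (Num.max t 0).
Proof.
move=> n0; rewrite normrM ger0_norm ?powR_ge0 // normr_prod.
have p_ge1 p : p \in primes n -> 1 <= p%:R :> R.
  by rewrite mem_primes => /andP[/prime_gt0 p0 _]; rewrite ler1n.
case: (ltP t 0) => [tn|tp].
  rewrite powRr0.
  have nt : n%:R `^ t * n%:R `^ (- t) = 1 :> R.
    by rewrite -powRD ?subrr ?powRr0 // pnatr_eq0 -lt0n n0 implybT.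
  rewrite -[leRHS]nt ler_wpM2l ?powR_ge0 //.
  have rad_le : (\prod_(p <- primes n) p <= n)%N.
    rewrite [leqRHS]prod_prime_decomp // prime_decompE big_map.
    rewrite big_seq [leqRHS]big_seq; apply: leq_prod => p /=.
    rewrite mem_primes => /and3P[pp _ pn].
    by rewrite -{1}[p]expn1 leq_exp2l ?prime_gt1 // logn_gt0 mem_primes pp n0.
  have radM : {morph (fun k : nat => (k%:R : R) `^ (- t)) : k l / (k * l)%N >-> k * l}.
    by move=> k l; rewrite natrM powRM.
  have nt0 : 0 <= - t by rewrite oppr_ge0 ltW.
  apply: (@le_trans _ _ ((\prod_(p <- primes n) p)%N%:R `^ (- t))).
    rewrite (big_morph _ radM (_ : _ = 1)) ?powR1 //.
    rewrite big_seq [leRHS]big_seq; apply: ler_prod => p pn.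
    have p1 : 1 <= p%:R `^ (- t) by rewrite -[leLHS](powRr0 (p%:R : R)) ler_powR ?p_ge1.
    by rewrite normr_ge0 /= ler0_norm ?subr_le0 // opprB gerBl.
  by apply: ge0_ler_powR; rewrite ?nnegrE ?ler_nat.
rewrite ler_piMr ?powR_ge0 //; rewrite big_seq.
apply: prodr_ile1 => p pn; rewrite normr_ge0 /= ger0_norm.
  by rewrite gerBl powR_ge0.
by rewrite subr_ge0 -[leRHS](powRr0 (p%:R : R)) ler_powR ?p_ge1 // oppr_le0.
Qed.
End Jordan.

(** * Euler products *)

(* The numbers whose prime factors are all < N, with exponents all < K. *)
Fixpoint smooth_numbers K N : seq nat :=
  if N isn't p.+1 then [:: 1%N] else
  if prime p then [seq (p ^ k * m)%N | k <- iota 0 K, m <- smooth_numbers K p]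
  else smooth_numbers K p.

Lemma smooth_numbers_prime_lt K N m : m \in smooth_numbers K N ->
  (0 < m)%N /\ forall q, prime q -> (q %| m)%N -> (q < N)%N.
Proof.
elim: N m => [|p IH] m /=.
  rewrite inE => /eqP->; split=> // q qp; rewrite dvdn1 => /eqP q1.
  by rewrite q1 in qp.
case: ifP => [pp /allpairsP[[k m'] /= [_ /IH[m0 mq] ->]]|_ /IH[m0 mq]].
  rewrite muln_gt0 expn_gt0 prime_gt0 // m0; split=> // q qp.
  rewrite Euclid_dvdM // Euclid_dvdX // => /orP[/andP[]|/(mq _ qp)/ltnW //].
  by rewrite dvdn_prime2 // => /eqP->.
by split=> // q qp /(mq _ qp)/ltnW.
Qed.

Lemma smooth_numbers_coprime K p m : prime p -> m \in smooth_numbers K p ->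
  coprime p m.
Proof.
move=> pp /smooth_numbers_prime_lt[_ mq].
by rewrite prime_coprime //; apply/negP => /(mq _ pp); rewrite ltnn.
Qed.

Lemma smooth_numbers_uniq K N : uniq (smooth_numbers K N).
Proof.
elim: N => [|p IH] //=; case: ifP => // pp.
apply: allpairs_uniq => //; first exact: iota_uniq.
move=> _ _ /allpairsP[[k m] /= [_ mS ->]] /allpairsP[[k' m'] /= [_ mS' ->]] /= E.
have logE l n : n \in smooth_numbers K p -> logn p (p ^ l * n) = l.
  by move=> nS; rewrite mulnC logn_Gauss ?pfactorK // (smooth_numbers_coprime pp nS).
have kE : k = k' by rewrite -(logE k m) // E logE.
by move/eqP: E; rewrite kE eqn_pmul2l ?expn_gt0 ?prime_gt0 // => /eqP->.
Qed.

Lemma mem_smooth_numbers K N n : (0 < n)%N ->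
    (forall q, prime q -> (q %| n)%N -> (q < N)%N) ->
    (forall q, (logn q n < K)%N) ->
  n \in smooth_numbers K N.
Proof.
elim: N n => [|p IH] n n0 nN nK /=.
  rewrite inE eqn_leq n0 andbT leqNgt; apply/negP => n1.
  by have := nN _ (pdiv_prime n1) (pdiv_dvd n).
case: ifP => pp; last first.
  apply: IH => // q qp qn; have := nN _ qp qn; rewrite ltnS leq_eqVlt.
  by case/orP => // /eqP qE; rewrite qE pp in qp.
apply/allpairsP; exists (logn p n, n`_p^')%N.
split; rewrite /= -?p_part ?partnC //; first by rewrite mem_iota nK.
apply: IH; first exact: part_gt0.
- move=> q qp qn; have := nN _ qp (dvdn_trans qn (dvdn_part _ _)).
  rewrite ltnS leq_eqVlt => /orP[/eqP qE|//].
  have /(pnatP _ (part_gt0 _ _)) := part_pnat (p^')%N n => /(_ q qp qn).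
  by rewrite qE !inE eqxx.
- by move=> q; apply: leq_ltn_trans (nK q); apply: dvdn_leq_log (dvdn_part _ _).
Qed.

Lemma cvgn_norm_le (R : realType) (u : nat -> R) (l M : R) : u @ \oo --> l ->
  (\forall n \near \oo, `|u n| <= M) -> `|l| <= M.
Proof. by move=> ul; exact: (ler_cvg_to (cvg_norm ul) (cvg_cst M)). Qed.

Section EulerProduct.
Context {R : realType}.
Variables (c F : nat -> R) (T : nat -> R).
Hypothesis c1 : c 1 = 1.
Hypothesis cM : forall m n, (0 < m)%N -> (0 < n)%N -> coprime m n ->
  c (m * n)%N = c m * c n.
Hypothesis cT : forall M M', \sum_(M <= n < M') `|c n| <= T M.
Hypothesis cF : forall p, prime p ->
  \sum_(0 <= k < K) c (p ^ k)%N @[K --> \oo] --> F p.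

Lemma sum_smooth_numbers K N :
  \sum_(n <- smooth_numbers K N) c n =
  prime_partial_prod (fun p => \sum_(0 <= k < K) c (p ^ k)%N) N.
Proof.
elim: N => [|p IH] /=; first by rewrite big_seq1 c1 /prime_partial_prod big_geq.
rewrite /prime_partial_prod [RHS]big_mkcond [in RHS]big_nat_recr //= -[in RHS]big_mkcond /=.
rewrite -[X in X * _]/(prime_partial_prod _ _) -IH; case: ifP => pp; last by rewrite mulr1.
rewrite big_allpairs_dep mulrC big_distrl /= /index_iota subn0.
apply: eq_bigr => k _; rewrite big_distrr /= big_seq [RHS]big_seq.
apply: eq_bigr => m mS; rewrite cM ?expn_gt0 ?(prime_gt0 pp) //.
by case: (smooth_numbers_prime_lt mS).
exact/coprimeXl/(smooth_numbers_coprime pp mS).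
Qed.

(** Every $n$ with $1 \le n < N$ is among the smooth numbers: its primes are below $N$ and their
    exponents below $N \le K$. The remaining smooth numbers are at least $N$, so they are controlled
    by the tail bound $T(N)$. *)
Lemma dist_sum_smooth_numbers K N : (N <= K)%N ->
  `|\sum_(n <- smooth_numbers K N) c n - \sum_(1 <= n < N) c n| <= T N.
Proof.
move=> NK; set s := smooth_numbers K N.
pose M := (\max_(n <- s) n).+1.
have sE : \sum_(n <- s) c n =
    \sum_(1 <= n < N) c n + \sum_(N <= n < maxn N M | n \in s) c n.
  have -> : \sum_(1 <= n < N) c n = \sum_(0 <= n < N | n \in s) c n.
    case: N @s @M NK => [|N] s M NK; first by rewrite !big_geq.
    rewrite [RHS]big_mkcond [RHS]big_ltn //= ifN ?add0r; last first.
      by apply/negP => /smooth_numbers_prime_lt[].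
    apply: eq_big_nat => n /andP[n1 nN]; rewrite mem_smooth_numbers // => q.
      by move=> _ /(dvdn_leq n1) qn; exact: leq_ltn_trans nN.
    by apply: leq_trans NK; apply: leq_ltn_trans nN; exact/ltnW/ltn_logl.
  rewrite -big_cat_nat ?leq_maxl // -[RHS]big_filter; apply: perm_big.
  apply: uniq_perm; rewrite ?filter_uniq ?iota_uniq ?smooth_numbers_uniq // => n.
  rewrite mem_filter mem_index_iota; apply/idP/andP => [ns|[]//]; split=> //.
  by rewrite leq0n /= leq_max ltnS orbC (leq_bigmax_seq _ ns).
rewrite {}sE addrAC subrr add0r; apply: le_trans (cT N (maxn N M)).
apply: le_trans (ler_norm_sum _ _ _) _.
rewrite big_mkcond; apply: ler_sum => n _; case: ifP => // _; exact: normr_ge0.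
Qed.

(** The limit $K \to \infty$ of the previous bound, for fixed $N$. The tail bound $T$ is kept
    general: it is explicit in [local_zeta2_approx] and only known to tend to $0$ in
    [euler_product_cvg]. *)
Lemma dist_prime_partial_prod_sum N :
  `|prime_partial_prod F N - \sum_(1 <= n < N) c n| <= T N.
Proof.
have PF : prime_partial_prod (fun p => \sum_(0 <= k < K) c (p ^ k)%N) N @[K --> \oo]
    --> prime_partial_prod F N.
  rewrite /prime_partial_prod; elim: N => [|p IH].
    under eq_fun do rewrite big_geq //; rewrite big_geq //; exact: cvg_cst.
  rewrite [X in _ --> X]big_mkcond /= big_nat_recr //= -big_mkcond /=.
  under eq_fun do rewrite big_mkcond big_nat_recr //= -big_mkcond /=.
  case: ifP => pp; first by apply: cvgM => //; exact: cF.
  by apply: cvgM => //; exact: cvg_cst.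
apply: (cvgn_norm_le (cvgB PF (cvg_cst (\sum_(1 <= n < N) c n)))).
near=> K; rewrite fctE /= -sum_smooth_numbers; apply: dist_sum_smooth_numbers.
by near: K; exact: nbhs_infty_ge.
Unshelve. all: by end_near.
Qed.

End EulerProduct.

Lemma euler_product_cvg (R : realType) (c F : nat -> R) (B : R) :
    c 1%N = 1 ->
    (forall m n, (0 < m)%N -> (0 < n)%N -> coprime m n ->
      c (m * n)%N = c m * c n) ->
    (forall p, prime p -> \sum_(0 <= k < K) c (p ^ k)%N @[K --> \oo] --> F p) ->
    (forall N, \sum_(0 <= n < N) `|c n| <= B) ->
  cvgn (prime_partial_prod F) /\
  \sum_(1 <= n < N) c n @[N --> \oo] --> prime_prod F.
Proof.
move=> c1 cM cF cB; pose S N := \sum_(0 <= n < N) `|c n|.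
have Sle : nondecreasing_seq S.
  by apply/nondecreasing_seqP => n; rewrite /S big_nat_recr //= lerDl.
have Scv : cvgn S.
  by apply: nondecreasing_is_cvgn Sle _; exists B => _ [N _ <-]; exact: cB.
(* The exact tail of the absolutely convergent series; it bounds the distance from partial product
   to partial sum and tends to $0$. *)
pose T M := limn S - S M.
have cT M M' : \sum_(M <= n < M') `|c n| <= T M.
  rewrite /T; have [MM'|M'M] := leqP M M'; last first.
    by rewrite big_geq 1?ltnW // subr_ge0; exact: nondecreasing_cvgn_le.
  rewrite lerBrDl -big_cat_nat //; exact: nondecreasing_cvgn_le.
have T0 : T @ \oo --> 0.
  by rewrite -(subrr (limn S)); apply: cvgB => //; exact: cvg_cst.
have Ccv : cvgn (fun N => \sum_(1 <= n < N) c n).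
  by rewrite is_cvg_series_restrict; apply: normed_cvg.
have PC := dist_prime_partial_prod_sum c1 cM cT cF.
have PCcv : prime_partial_prod F @ \oo --> limn (fun N => \sum_(1 <= n < N) c n).
  apply: (@cvg_sub0 _ _ _ _ _ _ (fun N => \sum_(1 <= n < N) c n)) => //.
  apply/norm_cvg0P; apply: (squeeze_cvgr _ (cvg_cst 0) T0).
  by near=> N; rewrite normr_ge0 PC.
split; first exact: cvgP PCcv.
by rewrite /prime_prod (cvg_lim _ PCcv).
Unshelve. all: by end_near.
Qed.

(** * Elementary sums *)

Section Sums.
Context {R : realType}.

Lemma harmonic_sum_le (X : nat) : (0 < X)%N ->
  \sum_(1 <= n < X.+1) n%:R^-1 <= 1 + ln X%:R :> R.
Proof.
case: X => // X _; elim: X => [|X IH]; first by rewrite big_nat1 ln1 invr1 addr0.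
rewrite big_nat_recr //=; apply: le_trans (lerD IH (lexx _)) _.
rewrite -addrA lerD2l -lerBrDl -opprB lerNr.
have X0 : 0 < X.+1%:R / X.+2%:R :> R by rewrite divr_gt0.
rewrite -ln_div ?posrE //.
have -> : X.+1%:R / X.+2%:R = 1 + - X.+2%:R^-1 :> R.
  have y0 : X.+2%:R != 0 :> R by rewrite pnatr_eq0.
  by rewrite -(addrK 1 X.+1%:R) natr1; field.
have y1 : 1 < X.+2%:R :> R by rewrite ltr1n.
have : X.+2%:R^-1 < 1 :> R by rewrite invf_lt1 // ltr0n.
by move=> y1'; apply: le_ln1Dx; rewrite ltrN2.
Qed.

(** Since $n^{-2} \le 2/n - 2/(n+1)$, the sum telescopes to at most $2/M \le 4/(M+1)$ for $M \ge 1$.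
    The form $4/(M+1)$ also covers $M = 0$, where the term at $0$ is $0^{-1} = 0$. *)
Lemma sum_inv_sqr_le (M M' : nat) :
  \sum_(M <= n < M') (n%:R ^+ 2)^-1 <= 4 / (M%:R + 1) :> R.
Proof.
have step (n : nat) : ((n.+1)%:R ^+ 2)^-1 <= 2 / (n.+1)%:R - 2 / (n.+2)%:R :> R.
  have n0 : 0 < (n.+1)%:R :> R by rewrite ltr0n.
  have n1 : 1 <= (n.+1)%:R :> R by rewrite ler1n.
  rewrite -[X in _ <= _ - 2 / X]natr1; move: (n.+1%:R : R) n0 n1 => y y0 y1.
  have -> : 2 / y - 2 / (y + 1) = 2 / (y * (y + 1)) by field; apply/andP; split; lra.
  rewrite -[X in X <= _]mul1r ler_pdivrMr ?exprn_gt0 // mulrAC.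
  rewrite ler_pdivlMr ?mulr_gt0 ?addr_gt0 //; nra.
have tail (m : nat) : \sum_(m.+1 <= n < M') (n%:R ^+ 2)^-1 <= 2 / m.+1%:R :> R.
  have [mM|Mm] := leqP m.+1 M'; last by rewrite big_geq ?divr_ge0 // ltnW.
  suff : \sum_(m.+1 <= n < M') (n%:R ^+ 2)^-1 <= 2 / m.+1%:R - 2 / M'%:R :> R.
    by move=> /le_trans; apply; rewrite gerBl divr_ge0.
  elim: M' mM => // k IH; rewrite leq_eqVlt => /orP[/eqP[->]|mk].
    by rewrite big_geq // subrr.
  rewrite big_nat_recr //=; apply: le_trans (lerD (IH mk) (lexx _)) _.
  case: k mk {IH} => // k _; have := step k.
  move: (2 / m.+1%:R : R) (2 / k.+1%:R : R) (2 / k.+2%:R : R) (_ ^-1 : R).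
  by move=> a b c e; lra.
have [->|M0] := posnP M.
  case: M' tail => [|k] tail; first by rewrite big_geq // divr_ge0 // add0r.
  rewrite big_ltn // expr0n /= invr0 add0r.
  by apply: le_trans (tail 0%N) _; rewrite add0r; lra.
case: M M0 => // m _; apply: le_trans (tail m) _.
have m1 : 1 <= m.+1%:R :> R by rewrite ler1n.
rewrite ler_pdivlMr ?addr_gt0 ?ltr0n // mulrAC ler_pdivrMr ?ltr0n //; lra.
Qed.

(** A mean value estimate uniform in $r > 0$: $(1-1/a)^r \le e^{-r/a} \le (1+r/a)^{-1}$ bounds the
    difference below by $a^r\, r/(a+r)$, and $a + r \le a(1+r)$. *)
Lemma powR_sub_ge (r a : R) : 0 < r -> 1 <= a ->
  r / (1 + r) * a `^ (r - 1) <= a `^ r - (a - 1) `^ r.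
Proof.
move=> r0 a1; have a0 : 0 < a by lra.
have Ea : a `^ (r - 1) = a `^ r / a.
  by rewrite powRB ?(gt_eqF a0) ?implybT // powRr1 // ltW.
have ar0 : 0 < a `^ r by exact: powR_gt0.
rewrite Ea.
have [a1'|a1'] := eqVneq a 1.
  rewrite a1' subrr powR1 powR0 ?gt_eqF // invr1 !mulr1 subr0.
  by rewrite ler_pdivrMr ?mul1r; lra.
have b0 : 0 < 1 - a^-1 by rewrite subr_gt0 invf_lt1 // lt_neqAle eq_sym a1' a1.
have Eb : (a - 1) `^ r <= a `^ r / (1 + r / a).
  have -> : a - 1 = a * (1 - a^-1) by rewrite mulrBr mulr1 divff ?gt_eqF.
  rewrite powRM ?(ltW a0) ?(ltW b0) // ler_pM2l //.
  have ra0 : 0 < 1 + r / a by rewrite addr_gt0 // divr_gt0.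
  rewrite /powR gt_eqF // -[X in X <= _]invrK lef_pV2 ?posrE ?invr_gt0 ?expR_gt0 //.
  rewrite -expRN; apply: le_trans (expR_ge1Dx _) _; rewrite ler_expR.
  rewrite -mulrN ler_pM2l // lerNr; apply: le_ln1Dx.
  by rewrite ltrNl opprK; lra.
apply: le_trans (lerB (lexx _) Eb).
have -> : a `^ r - a `^ r / (1 + r / a) = a `^ r * (r / (a + r)).
  by field; rewrite !gt_eqF //= addr_gt0.
rewrite mulrCA ler_pM2l // -mulrA -invfM ler_pM2l // lef_pV2 ?posrE ?mulr_gt0 ?addr_gt0 //; nra.
Qed.

(** Induction on $Y$; the constant is the inverse of the factor in [powR_sub_ge], applied at $a =
    Y+1$. *)
Lemma sum_powR_le (r : R) (Y : nat) : 0 < r ->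
  \sum_(1 <= n < Y.+1) n%:R `^ (r - 1) <= (1 + r) / r * Y%:R `^ r :> R.
Proof.
move=> r0; elim: Y => [|Y IH]; first by rewrite big_geq // powR0 ?gt_eqF // mulr0.
rewrite big_nat_recr //=; apply: le_trans (lerD IH (lexx _)) _.
have := @powR_sub_ge r Y.+1%:R r0; rewrite ler1n => /(_ isT).
rewrite -natr1 addrK => h.
have k0 : 0 < (1 + r) / r by rewrite divr_gt0 // addr_gt0.
rewrite -lerBrDl -mulrBr -ler_pdivrMl //; apply: le_trans h.
by rewrite invf_div.
Qed.

(** Each term is at most a constant times $n^{-r} - (n+1)^{-r}$, by [powR_sub_ge] at $a = n+1$, and
    the sum telescopes. The extra factor $2$ comes from $n+1 \le 2n$. *)
Lemma tail_powR_le (r : R) (M M' : nat) : 0 < r -> (0 < M)%N ->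
  \sum_(M <= n < M') n%:R `^ (- r - 1) <=
    2 * (1 + r) / r * M%:R `^ (- r) :> R.
Proof.
move=> r0 M0; set k := 2 * (1 + r) / r.
have k0 : 0 < k by rewrite divr_gt0 ?mulr_gt0 // addr_gt0.
have step (n : nat) : (0 < n)%N ->
    n%:R `^ (- r - 1) <= k * (n%:R `^ (- r) - n.+1%:R `^ (- r)) :> R.
  move=> n0; have n0' : 0 < n%:R :> R by rewrite ltr0n.
  have m0' : 0 < n.+1%:R :> R by rewrite ltr0n.
  have u0 : 0 < n%:R `^ r :> R by exact: powR_gt0.
  have v0 : 0 < n.+1%:R `^ r :> R by exact: powR_gt0.
  have := @powR_sub_ge r n.+1%:R r0; rewrite ler1n => /(_ isT).
  rewrite -[X in _ - (X - 1) `^ _]natr1 addrK.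
  rewrite !powRB ?(gt_eqF n0') ?(gt_eqF m0') ?implybT // !powRr1 ?ler0n // !powRN.
  have : n.+1%:R <= 2 * n%:R :> R by rewrite -natrM ler_nat; lia.
  move: (n%:R `^ r : R) (n.+1%:R `^ r : R) u0 v0 => u v u0 v0.
  move: (n%:R : R) (n.+1%:R : R) n0' m0' => x y x0 y0 yx h.
  have -> : k * (u^-1 - v^-1) = k * ((v - u) / (u * v)).
    by field; rewrite !gt_eqF.
  apply: (@le_trans _ _ (k * ((r / (1 + r) * (v / y)) / (u * v)))).
    have -> : k * (r / (1 + r) * (v / y) / (u * v)) = 2 / (u * y).
      by rewrite /k; field; rewrite !gt_eqF ?addr_gt0.
    rewrite -invfM -[X in X <= _]mul1r ler_pdivrMr ?mulr_gt0 // mulrAC.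
    by rewrite ler_pdivlMr ?mulr_gt0 // mul1r mulrCA ler_pM2l.
  by rewrite ler_pM2l // ler_pM2r // invr_gt0 mulr_gt0.
have [MM'|MM'] := leqP M M'; last first.
  by rewrite big_geq 1?ltnW // mulr_ge0 ?powR_ge0 // ltW.
suff : \sum_(M <= n < M') n%:R `^ (- r - 1) <= k * (M%:R `^ (- r) - M'%:R `^ (- r)).
  by move=> /le_trans; apply; rewrite ler_pM2l // gerBl powR_ge0.
elim: M' MM' => [|m IH]; first by rewrite leqn0 => /eqP M00; rewrite M00 in M0.
rewrite leq_eqVlt => /orP[/eqP->|mk]; first by rewrite big_geq // subrr mulr0.
rewrite big_nat_recr //=; apply: le_trans (lerD (IH mk) (step _ _)) _.
  exact: leq_trans M0 mk.
by rewrite -mulrDr addrA subrK.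
Qed.
End Sums.

(** * Asymptotic counts *)

Lemma totient_leq n : (totient n <= n)%N.
Proof.
rewrite totient_count_coprime -[leqRHS]subn0 -[leqRHS]muln1 -sum_nat_const_nat.
by apply: leq_sum => i _; case: coprime.
Qed.

Section Estimates.
Context {R : realType}.

(** With $w = z/d$ and $q = \lfloor Z/d \rfloor$, the count and $\varphi(d)w^2$ both lie between
    $\varphi(d)q^2$ and $\varphi(d)(q+1)^2$. For $q \ge 1$ they differ by at most $\varphi(d)(2q+1)
    \le 3dw = 3z$; for $q = 0$ both are at most $z$. *)
Lemma coprime_pair_count_approx (d Z : nat) (z : R) : (0 < d)%N -> Z%:R <= z < Z%:R + 1 ->
  `|(coprime_pair_count d Z)%:R - (totient d)%:R * (z / d%:R) ^+ 2| <=
  Num.min (3 * z) (6 * z ^+ 2 / d%:R).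
Proof.
move=> d0 /andP[Zz zZ].
have dR : 1 <= d%:R :> R by rewrite ler1n.
have dR0 : 0 < d%:R :> R by lra.
have Z0 : 0 <= Z%:R :> R by rewrite ler0n.
have z0 : 0 <= z by lra.
set w := z / d%:R; have zE : z = w * d%:R by rewrite /w divfK // gt_eqF.
have w0 : 0 <= w by rewrite divr_ge0 // ltW.
have phi_d : (totient d)%:R <= d%:R :> R by rewrite ler_nat totient_leq.
have phi0 : 0 <= (totient d)%:R :> R by rewrite ler0n.
have eZ : `|(coprime_pair_count d Z)%:R - (totient d)%:R * w ^+ 2| <= 3 * z.
  have /andP[M1] := coprime_pair_count_bounds Z d0; rewrite leq_min => /andP[M2 M3].
  set q := (Z %/ d)%N in M1 M2 M3.
  have qZ : (q * d)%:R <= Z%:R :> R by rewrite ler_nat leq_trunc_div.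
  have Zq : Z%:R + 1 <= (q.+1 * d)%:R :> R by rewrite natr1 ler_nat ltn_ceil.
  have qw : q%:R <= w by rewrite ler_pdivlMr // -natrM (le_trans qZ).
  have wq : w <= q%:R + 1.
    by rewrite ler_pdivrMr // natr1 -natrM; apply: le_trans Zq; exact: ltW.
  move: M1 M2 M3; rewrite -!(ler_nat R) !natrM -!natr1 -!expr2.
  move: (coprime_pair_count d Z)%:R ((totient d)%:R : R) phi_d phi0 => M phi phi_d phi0.
  move=> M1 M2 M3.
  have [q0|q0] := posnP q.
    rewrite q0 add0r mulr1 in wq M3.
    have : phi * w ^+ 2 <= z by nra.
    have : 0 <= phi * w ^+ 2 by rewrite mulr_ge0 // sqr_ge0.
    have : 0 <= M by apply: le_trans M1; rewrite mulr_ge0 // sqr_ge0.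
    by move=> ? ? ?; rewrite ler_norml; apply/andP; split; lra.
  have q1 : 1 <= q%:R :> R by rewrite ler1n.
  move: (q%:R : R) q1 qw wq M1 M2 => Q Q1 Qw wQ M1 M2.
  have l : phi * Q ^+ 2 <= phi * w ^+ 2 by rewrite ler_wpM2l // lerXn2r ?nnegrE //; lra.
  have u : phi * w ^+ 2 <= phi * (Q + 1) ^+ 2.
    by rewrite ler_wpM2l // lerXn2r ?nnegrE //; lra.
  have e : phi * (2 * Q + 1) <= 3 * z by rewrite zE; nra.
  have eq : phi * (Q + 1) ^+ 2 = phi * Q ^+ 2 + phi * (2 * Q + 1) by ring.
  by rewrite ler_norml; apply/andP; split; lra.
rewrite le_min eZ /=.
(* For the second bound, either the count is $0$ and $\varphi(d)w^2 \le z^2/d$, or $d \le 2z$ and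
   $3z \le 6z^2/d$. *)
have [Zd|dZ] := ltnP (2 * Z) d.
  rewrite coprime_pair_count_eq0 // sub0r normrN ger0_norm ?mulr_ge0 ?sqr_ge0 //.
  have -> : 6 * z ^+ 2 / d%:R = 6 * (d%:R * w ^+ 2).
    by rewrite /w; field; rewrite gt_eqF.
  have : (totient d)%:R * w ^+ 2 <= d%:R * w ^+ 2 by rewrite ler_wpM2r ?sqr_ge0.
  have : 0 <= d%:R * w ^+ 2 by rewrite mulr_ge0 ?sqr_ge0 // ltW.
  lra.
apply: le_trans eZ _; rewrite ler_pdivlMr //.
have : d%:R <= 2 * Z%:R :> R by rewrite -natrM ler_nat.
nra.
Qed.

(** The value of $\sum n^{-2}$ over the $n$ all of whose primes divide $d$. *)
Definition local_zeta2 (d : nat) : R :=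
  \prod_(p <- primes d) (1 - (p%:R ^+ 2)^-1)^-1.

Lemma sqr_prime_inv_lt1 p : prime p -> 0 < ((p%:R : R) ^+ 2)^-1 < 1.
Proof.
move=> pp; have p1 : 1 < p%:R :> R by rewrite ltr1n prime_gt1.
by rewrite invr_gt0 exprn_gt0 ?invf_lt1 ?exprn_egt1 ?exprn_gt0 //; lra.
Qed.

Lemma cvg_geometric_sum (q : R) : `|q| < 1 ->
  \sum_(0 <= k < K) q ^+ k @[K --> \oo] --> (1 - q)^-1.
Proof.
move=> q1; rewrite -[X in _ --> X]mul1r.
have := @cvg_geometric_series _ 1 q q1.
by under [X in X @ _]funext => K do
  (rewrite /series /=; under eq_bigr do rewrite mul1r).
Qed.

(** The Euler product comparison for $n^{-2}$ restricted to such $n$, with tail bound $T(M) =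
    4/(M+1)$. Comparing at a cut-off $N$ and then returning from $N$ to $X$ costs at most $T(X+1)$
    each. *)
Lemma local_zeta2_approx (d X : nat) : (0 < d)%N ->
  `|local_zeta2 d - \sum_(1 <= n < X.+1 | \pi(d).-nat n) (n%:R ^+ 2)^-1|
    <= 8 / X.+2%:R.
Proof.
move=> d0; pose c n : R := if \pi(d).-nat n then (n%:R ^+ 2)^-1 else 0.
pose F p : R := if p \in primes d then (1 - (p%:R ^+ 2)^-1)^-1 else 1.
pose T M : R := 4 / (M%:R + 1).
have c1 : c 1%N = 1 by rewrite /c expr1n invr1.
have cM m n : (0 < m)%N -> (0 < n)%N -> coprime m n ->
    c (m * n)%N = c m * c n.
  move=> _ _ _; rewrite /c pnatM natrM exprMn invfM.
  by case: ifP => [/andP[-> ->]//|]; case: pnat => /= [->|]; rewrite ?mulr0 ?mul0r.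
have cT M M' : \sum_(M <= n < M') `|c n| <= T M.
  apply: le_trans (sum_inv_sqr_le M M'); apply: ler_sum => n _; rewrite /c.
  by case: ifP; rewrite ?normr0 ?ger0_norm ?invr_ge0 ?sqr_ge0.
have cF p : prime p -> \sum_(0 <= k < K) c (p ^ k)%N @[K --> \oo] --> F p.
  move=> pp; rewrite /F; case: ifP => pd.
    have /andP[p0 p1] := sqr_prime_inv_lt1 pp.
    under [X in X @ _]funext => K.
      under eq_bigr => k _.
        rewrite /c pnatX pnatE // [_ \in _]pd /= natrX -exprM mulnC exprM -exprVn.
        over.
      over.
    by apply: cvg_geometric_sum; rewrite ger0_norm // ltW.
  rewrite -cvg_shiftS /=; under [X in X @ _]funext => K.
    rewrite big_nat_recl // big1 ?addr0.
      over.
    move=> k _; rewrite /c pnatX pnatE // [_ \in _]pd //.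
  by rewrite expn0 c1; exact: cvg_cst.
have GN N := dist_prime_partial_prod_sum c1 cM cT cF N.
(* Beyond $d$, the partial product contains every prime of $d$ and equals [local_zeta2 d]. *)
pose N := (maxn d X).+1; have := GN N.
have -> : prime_partial_prod F N = local_zeta2 d.
  rewrite /prime_partial_prod /local_zeta2 /F -big_mkcondr /= -big_filter.
  apply: perm_big; apply: uniq_perm; rewrite ?primes_uniq ?filter_uniq ?iota_uniq //.
  move=> p; rewrite mem_filter mem_primes mem_index_iota d0 leq0n /= ltnS.
  apply/idP/idP => [/andP[/and3P[_ -> ->]]//|/andP[pp pd]].
  by rewrite pp pd /= leq_max dvdn_leq.
have -> : \sum_(1 <= n < N) c n = \sum_(1 <= n < X.+1) c n + \sum_(X.+1 <= n < N) c n.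
  by rewrite -big_cat_nat // ltnS leq_maxr.
rewrite -[\sum_(1 <= n < X.+1) c n]big_mkcond /= => h1.
have h2 : `|\sum_(X.+1 <= n < N) c n| <= T X.+1.
  exact: le_trans (ler_norm_sum _ _ _) (cT _ _).
have h3 : T N <= T X.+1.
  rewrite /T ler_pM2l // lef_pV2 ?posrE ?addr_gt0 ?ltr0n // lerD2r ler_nat.
  by rewrite ltnS leq_maxr.
have -> : 8 / X.+2%:R = T X.+1 + T X.+1 by rewrite /T natr1; ring.
move: h1 h2 h3; move: (\sum_(X.+1 <= n < N) _) (\sum_(1 <= n < _ | _) _).
move=> a b h1 h2 h3.
rewrite (_ : _ - b = (local_zeta2 d - (b + a)) + a); last by ring.
by apply: le_trans (ler_normD _ _) _; apply: lerD h2; exact: le_trans h1 h3.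
Qed.

Lemma local_zeta2_ge0 d : 0 <= local_zeta2 d.
Proof.
rewrite /local_zeta2 big_seq; apply: prodr_ge0 => p.
rewrite mem_primes => /andP[/sqr_prime_inv_lt1/andP[_ p1] _].
by rewrite invr_ge0 subr_ge0 ltW.
Qed.

Lemma local_zeta2_le d : (0 < d)%N -> local_zeta2 d <= 4.
Proof.
move=> d0; have := local_zeta2_approx 0 d0.
by rewrite big_geq // subr0 ger0_norm ?local_zeta2_ge0 //; lra.
Qed.

(* The density of the pairs [(a, b)] such that [d] divides [gcd_ratio a b]. *)
Definition dvd_density (d : nat) : R :=
  (totient d)%:R * local_zeta2 d / d%:R ^+ 4.

(** Two errors add up: [e1], from counting $(u,v)$ for each $n \le X$, and [e2], from completing the
    sum of $n^{-2}$ to all $n$. The constants are $11 = 3 + 8$, with a harmonic sum over $n$, and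
    $20 = 6 \cdot 2 + 8$, with $\sum n^{-2} \le 2$. *)
Lemma dvd_count_approx (d : nat) (x : R) (X := Num.truncn x) :
    (0 < d)%N -> 1 <= x ->
  `|(\sum_(1 <= a < X.+1) \sum_(1 <= b < X.+1) (d %| gcd_ratio a b))%:R
     - x ^+ 2 * dvd_density d| <=
  Num.min (11 * (x / d%:R) * (1 + ln x)) (20 * x ^+ 2 / d%:R ^+ 3).
Proof.
move=> d0 x1; rewrite sum_dvdn_gcd_ratio // natr_sum.
have x0 : 0 < x by lra.
have /andP[Xx xX] := truncn_itv (ltW x0).
have X0 : (0 < X)%N by rewrite truncn_gt0.
have dR : 1 <= d%:R :> R by rewrite ler1n.
have dR0 : 0 < d%:R :> R by lra.
set G := \sum_(1 <= n < X.+1 | \pi(d).-nat n) (n%:R ^+ 2)^-1 : R.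
pose z n := x / (d * n)%:R.
have zitv n : (0 < n)%N -> (X %/ (d * n))%:R <= z n < (X %/ (d * n))%:R + 1.
  move=> n0; have dn0 : (0 < d * n)%N by rewrite muln_gt0 d0.
  rewrite /z ler_pdivlMr ?ltr0n // ltr_pdivrMr ?ltr0n //.
  rewrite -natrM (le_trans _ Xx) ?ler_nat ?leq_trunc_div //=.
  by rewrite natr1 -natrM (lt_le_trans xX) // ler_nat ltn_ceil.
have mainE : \sum_(1 <= n < X.+1 | \pi(d).-nat n)
    (totient d)%:R * (z n / d%:R) ^+ 2 = x ^+ 2 * ((totient d)%:R * G / d%:R ^+ 4).
  rewrite /G mulr_sumr mulr_suml mulr_sumr; apply: eq_bigr => n /andP[n0 _].
  by rewrite /z natrM; field; rewrite gt_eqF //= gt_eqF // ltr0n.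
have e1 : `|\sum_(1 <= n < X.+1 | \pi(d).-nat n) (coprime_pair_count d (X %/ (d * n)))%:R
    - x ^+ 2 * ((totient d)%:R * G / d%:R ^+ 4)| <=
    \sum_(1 <= n < X.+1) Num.min (3 * z n) (6 * z n ^+ 2 / d%:R).
  rewrite -mainE -sumrB; apply: le_trans (ler_norm_sum _ _ _) _.
  rewrite big_mkcond big_nat_cond [leRHS]big_nat_cond.
  apply: ler_sum => n /andP[/andP[n0 _] _].
  have h := coprime_pair_count_approx d0 (zitv n n0).
  by case: ifP => // _; apply: le_trans h.
have e2 : `|x ^+ 2 * ((totient d)%:R * G / d%:R ^+ 4) - x ^+ 2 * dvd_density d| <=
    x ^+ 2 / d%:R ^+ 3 * (8 / X.+2%:R).
  rewrite /dvd_density distrC.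
  have -> : x ^+ 2 * ((totient d)%:R * local_zeta2 d / d%:R ^+ 4) -
      x ^+ 2 * ((totient d)%:R * G / d%:R ^+ 4) =
      x ^+ 2 / d%:R ^+ 3 * ((totient d)%:R / d%:R * (local_zeta2 d - G)).
    by field; rewrite gt_eqF.
  have xd : 0 <= x ^+ 2 / d%:R ^+ 3 by rewrite divr_ge0 ?exprn_ge0 // ltW.
  rewrite normrM (ger0_norm xd) ler_wpM2l // normrM.
  apply: le_trans (local_zeta2_approx X d0).
  rewrite ler_piMl // ger0_norm ?divr_ge0 ?ler0n // ler_pdivrMr // mul1r.
  by rewrite ler_nat totient_leq.
apply: le_trans (ler_distD _ _ _) _; apply: le_trans (lerD e1 e2) _.
rewrite le_min; apply/andP; split.
  have d3 : x / d%:R ^+ 3 <= x / d%:R.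
    by rewrite ler_pM2l // lef_pV2 ?posrE ?exprn_gt0 // ler_eXnr.
  have -> : 11 * (x / d%:R) * (1 + ln x) =
      3 * (x / d%:R) * (1 + ln x) + 8 * (x / d%:R) * (1 + ln x) by ring.
  have xd0 : 0 < x / d%:R by rewrite divr_gt0.
  have lnx : 0 <= ln x by rewrite ln_ge0.
  apply: lerD.
    apply: (@le_trans _ _ (3 * (x / d%:R) * \sum_(1 <= n < X.+1) n%:R^-1)).
      rewrite mulr_sumr; apply: ler_sum => n _; rewrite ge_min /z natrM invfM.
      by rewrite -!mulrA lexx.
    rewrite ler_wpM2l ?(mulr_ge0 _ (ltW xd0)) //; apply: le_trans (harmonic_sum_le X0) _.
    by rewrite lerD2l ler_ln ?posrE ?ltr0n.
  apply: (@le_trans _ _ (x ^+ 2 / d%:R ^+ 3 * (8 / x))).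
    rewrite ler_wpM2l ?divr_ge0 ?exprn_ge0 ?(ltW x0) ?(ltW dR0) // ler_pM2l //.
    rewrite lef_pV2 ?posrE ?ltr0n //; apply: le_trans (ltW xX) _.
    by rewrite ler_nat.
  have -> : x ^+ 2 / d%:R ^+ 3 * (8 / x) = 8 * (x / d%:R ^+ 3).
    by field; rewrite !gt_eqF.
  by nra.
have -> : 20 * x ^+ 2 / d%:R ^+ 3 =
    6 * x ^+ 2 / d%:R ^+ 3 * 2 + x ^+ 2 / d%:R ^+ 3 * 8 by field; rewrite gt_eqF.
have xd : 0 < x ^+ 2 / d%:R ^+ 3 by rewrite divr_gt0 ?exprn_gt0.
apply: lerD; last first.
  by rewrite ler_pM2l // ler_pdivrMr ?ltr0n // ler_peMr // ler1n.
apply: (@le_trans _ _ (6 * x ^+ 2 / d%:R ^+ 3 * \sum_(1 <= n < X.+1) (n%:R ^+ 2)^-1)).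
  rewrite mulr_sumr [leRHS]big_nat_cond [leLHS]big_nat_cond.
  apply: ler_sum => n /andP[/andP[n0 _] _]; rewrite ge_min /z.
  apply/orP; right; rewrite le_eqVlt; apply/orP; left; apply/eqP.
  by rewrite natrM; field; rewrite pnatr_eq0 -lt0n n0 gt_eqF.
rewrite ler_wpM2l //; last by apply: le_trans (sum_inv_sqr_le _ _) _; rewrite ler_pdivrMr ?addr_gt0 ?ltr0n //; lra.
by rewrite -mulrA mulr_ge0 // ltW.
Qed.
End Estimates.

(** * Summation over $d$ and the error term *)

Lemma gcd_ratio_le a b : (0 < a)%N -> (0 < b)%N -> (gcd_ratio a b <= a * b)%N.
Proof.
move=> a0 b0; apply: leq_trans (leq_div _ _) _.
by apply: dvdn_leq (dvdn_gcdl _ _); rewrite muln_gt0 a0.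
Qed.

Section Asymptotics.
Context {R : realType}.
Variable t : R.
Hypothesis ht2 : t < 2.
Hypothesis ht0 : t != 0.
(** The exponent $s$ bounds the growth of $H$. As the densities are $O(d^{-3})$, the coefficients
    $H(d)c(d)$ of the main term are $O(d^{-r-1})$, summable because $r > 0$. *)
Let s := Num.max t 0.
Let r := 2 - s.

Let s2 : s < 2. Proof. by rewrite gt_max ht2 /=. Qed.
Let r0 : 0 < r. Proof. by rewrite subr_gt0. Qed.

(** All values satisfy $f(a,b) \le ab \le X^2$, so every cut-off $N > X^2$ sees all their divisors.
    Leaving $N$ free allows letting it tend to infinity. *)
Lemma gcd_ratio_sum_jordan (x : R) (X := Num.truncn x) (N : nat) :
    (X * X < N)%N ->
  gcd_ratio_sum t x = \sum_(1 <= d < N) jordan t d *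
    (\sum_(1 <= a < X.+1) \sum_(1 <= b < X.+1) (d %| gcd_ratio a b))%:R.
Proof.
move=> XN; rewrite /gcd_ratio_sum -/X.
under [RHS]eq_bigr do rewrite natr_sum mulr_sumr.
rewrite [RHS]exchange_big /=.
apply: eq_big_nat => a /andP[a0 aX].
under [RHS]eq_bigr do rewrite natr_sum mulr_sumr.
rewrite [RHS]exchange_big /=.
apply: eq_big_nat => b /andP[b0 bX].
have f0 := gcd_ratio_gt0 b a0; rewrite -sum_jordan //.
have fN : (gcd_ratio a b < N)%N.
  apply: leq_ltn_trans XN; apply: leq_trans (gcd_ratio_le a0 b0) _.
  by apply: leq_mul; rewrite -ltnS.
transitivity (\sum_(1 <= d < N | (d %| gcd_ratio a b)%N) jordan t d).
  rewrite -[RHS]big_filter; apply: perm_big; apply: uniq_perm.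
  - exact: divisors_uniq.
  - by rewrite filter_uniq // iota_uniq.
  move=> d; rewrite mem_filter mem_index_iota -dvdn_divisors //.
  apply/idP/andP => [df|[]//]; split => //.
  by rewrite (dvdn_gt0 f0 df) (leq_ltn_trans _ fN) // dvdn_leq.
rewrite big_mkcond; apply: eq_bigr => d _.
by case: ifP => _; rewrite ?mulr1 ?mulr0.
Qed.

Let c (d : nat) : R := jordan t d * dvd_density d.

Lemma dvd_density_ge0 d : 0 <= dvd_density d :> R.
Proof. by rewrite divr_ge0 ?exprn_ge0 ?mulr_ge0 // local_zeta2_ge0. Qed.

Lemma dvd_density_le d : (0 < d)%N -> dvd_density d <= 4 / d%:R ^+ 3 :> R.
Proof.
move=> d0; have d0' : 0 < d%:R :> R by rewrite ltr0n.
rewrite /dvd_density ler_pdivrMr ?exprn_gt0 //.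
have -> : 4 / d%:R ^+ 3 * d%:R ^+ 4 = d%:R * 4 :> R by field; rewrite gt_eqF.
by rewrite ler_pM ?local_zeta2_ge0 ?local_zeta2_le // ler_nat totient_leq.
Qed.

Lemma powR_divXn (d k : nat) (u : R) : (0 < d)%N ->
  d%:R `^ u / d%:R ^+ k = d%:R `^ (u - k%:R).
Proof.
move=> d0; have d0' : 0 < d%:R :> R by rewrite ltr0n.
by rewrite powRB ?(gt_eqF d0') ?implybT // powR_mulrn // ltW.
Qed.

Lemma coef_le d : (0 < d)%N -> `|c d| <= 4 * d%:R `^ (- r - 1).
Proof.
move=> d0; rewrite /c normrM (ger0_norm (dvd_density_ge0 d)).
have -> : - r - 1 = s - 3%:R by rewrite /r; ring.
rewrite -powR_divXn // [leRHS]mulrCA; apply: ler_pM; rewrite ?normr_ge0 ?dvd_density_ge0 //.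
  exact: jordan_bound.
exact: dvd_density_le.
Qed.

Lemma coef_sum_le N : \sum_(0 <= n < N) `|c n| <= 4 * (2 * (1 + r) / r).
Proof.
have k0 : 0 <= 4 * (2 * (1 + r) / r).
  by rewrite mulr_ge0 // divr_ge0 ?(ltW r0) // mulr_ge0 // addr_ge0 // ltW.
case: N => [|N]; first by rewrite big_geq.
(* The term at $0$ vanishes because $0^t = 0$ for $t \ne 0$. *)
rewrite big_ltn // /c {1}/jordan powR0 // !mul0r normr0 add0r.
apply: (@le_trans _ _ (\sum_(1 <= n < N.+1) 4 * n%:R `^ (- r - 1))).
  rewrite big_nat_cond [leRHS]big_nat_cond.
  by apply: ler_sum => n /andP[/andP[n0 _] _]; exact: coef_le.
rewrite -mulr_sumr ler_pM2l //; apply: le_trans (tail_powR_le _ _ _) _ => //.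
by rewrite powR1 mulr1.
Qed.

Lemma coef1 : c 1%N = 1.
Proof.
by rewrite /c jordan1 /dvd_density /local_zeta2 big_nil expr1n divr1 !mul1r.
Qed.

Lemma coefM m n : (0 < m)%N -> (0 < n)%N -> coprime m n ->
  c (m * n)%N = c m * c n.
Proof.
move=> m0 n0 cmn; rewrite /c jordanM // /dvd_density /local_zeta2 prod_primesM //.
rewrite totient_coprime // !natrM exprMn invfM; ring.
Qed.

Lemma coef_prime_sum p : prime p ->
  \sum_(0 <= k < K) c (p ^ k)%N @[K --> \oo] --> euler_factor t p.
Proof.
move=> pp; rewrite -cvg_shiftS /=.
have p1 : 1 < p%:R :> R by rewrite ltr1n prime_gt1.
have p0 : 0 < p%:R :> R by lra.
pose P : R := p%:R `^ t; have P0 : 0 < P by exact: powR_gt0.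
have PP : P < p%:R ^+ 3.
  rewrite -powR_mulrn ?(ltW p0) //; apply: (@le_lt_trans _ _ (p%:R `^ 2)).
    by rewrite ler_powR ?ltW.
  by rewrite -[2]/(2%:R) !powR_mulrn ?(ltW p0) // ltr_eXn2l.
(* The coefficients at $p^{k+1}$ form a geometric progression $a q^k$ with $a$ the coefficient at
   $p$; $q = p^{t-3} < 1$ since $t < 2$. *)
pose q := P / p%:R ^+ 3.
pose a := (P - 1) * (p%:R - 1) / (1 - (p%:R ^+ 2)^-1) / p%:R ^+ 4.
have q1 : `|q| < 1.
  rewrite ger0_norm ?divr_ge0 ?exprn_ge0 ?(ltW P0) ?(ltW p0) //.
  by rewrite ltr_pdivrMr ?exprn_gt0 // mul1r.
have [p2 p2'] := andP (sqr_prime_inv_lt1 (R := R) pp).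
have -> : euler_factor t p = 1 + a * (1 - q)^-1.
  rewrite /euler_factor -/P /a /q; congr (1 + _).
  have h : 0 < p%:R ^+ 2 - 1 :> R by nra.
  have h' : 0 < p%:R ^+ 3 - P by rewrite subr_gt0.
  have p3 : 0 < p%:R + 1 :> R by lra.
  by field; rewrite !gt_eqF.
under [X in X @ _]funext => K.
  rewrite big_nat_recl // expn0 coef1.
  under eq_bigr => k _.
    have -> : c (p ^ k.+1) = a * q ^+ k.
      rewrite /c jordanX // /dvd_density /local_zeta2 prod_primesX //.
      have pk : 0 < (p%:R : R) ^+ k by rewrite exprn_gt0.
      rewrite totient_pfactor //= natrM !natrX -/P -subn1 natrB ?prime_gt0 //.
      rewrite /a /q expr_div_n (exprAC _ 3) !(exprS _ k).
      move: (p%:R ^+ k : R) (P ^+ k) pk => Q PK Q0.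
      have h : 0 < (p%:R : R) ^+ 2 - 1 by nra.
      by field; rewrite !gt_eqF.
    over.
  rewrite -mulr_sumr.
  over.
apply: cvgD; first exact: cvg_cst.
by apply: cvgM; [exact: cvg_cst|exact: cvg_geometric_sum].
Qed.

Lemma gcd_ratio_sum_approx (x : R) (Y := Num.truncn (Num.sqrt x)) : 1 <= x ->
  `|gcd_ratio_sum t x - x ^+ 2 * prime_prod (euler_factor t)| <=
  11 * x * (1 + ln x) * (\sum_(1 <= d < Y.+1) d%:R `^ (s - 1)) +
  20 * (2 * (1 + r) / r) * x `^ (1 + s / 2).
Proof.
move=> x1; have x0 : 0 < x by lra.
have [_ cP] := euler_product_cvg coef1 coefM coef_prime_sum coef_sum_le.
(* It suffices to bound the difference with the main series cut at $N$, for all large $N$: both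
   sides are then sums over the same $d < N$, compared term by term. *)
apply: (cvgn_norm_le (cvgB (cvg_cst (gcd_ratio_sum t x))
  (cvgM (cvg_cst (x ^+ 2)) cP))).
set X := Num.truncn x.
near=> N.
have XN : (X * X < N)%N by near: N; exact: nbhs_infty_gt.
have YN : (Y.+1 <= N)%N by near: N; exact: nbhs_infty_ge.
rewrite !fctE /= (gcd_ratio_sum_jordan XN) mulr_sumr -sumrB.
rewrite (eq_bigr (fun d => jordan t d *
  ((\sum_(1 <= a < X.+1) \sum_(1 <= b < X.+1) (d %| gcd_ratio a b))%:R -
   x ^+ 2 * dvd_density d))); last by move=> d _; rewrite /c mulrBr [x ^+ 2 * (_ * _)]mulrCA.
apply: le_trans (ler_norm_sum _ _ _) _.
rewrite (@big_cat_nat _ _ _ Y.+1) //=; apply: lerD.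
  rewrite mulr_sumr big_nat_cond [leRHS]big_nat_cond.
  apply: ler_sum => d /andP[/andP[d0 _] _]; rewrite normrM.
  have -> : 11 * x * (1 + ln x) * d%:R `^ (s - 1) =
      d%:R `^ s * (11 * (x / d%:R) * (1 + ln x)).
    by rewrite -[s - 1]/(s - 1%:R) -powR_divXn // expr1; ring.
  apply: ler_pM; rewrite ?normr_ge0 ?jordan_bound //.
  by apply: le_trans (dvd_count_approx d0 x1) _; rewrite ge_min lexx.
apply: (@le_trans _ _ (\sum_(Y.+1 <= d < N) 20 * x ^+ 2 * d%:R `^ (- r - 1))).
  rewrite big_nat_cond [leRHS]big_nat_cond.
  apply: ler_sum => d /andP[/andP[Yd _] _]; rewrite normrM.
  have d0 : (0 < d)%N by exact: leq_trans Yd.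
  have -> : 20 * x ^+ 2 * d%:R `^ (- r - 1) =
      d%:R `^ s * (20 * x ^+ 2 / d%:R ^+ 3).
    have -> : - r - 1 = s - 3%:R by rewrite /r; ring.
    by rewrite -powR_divXn //; ring.
  apply: ler_pM; rewrite ?normr_ge0 ?jordan_bound //.
  by apply: le_trans (dvd_count_approx d0 x1) _; rewrite ge_min lexx orbT.
rewrite -mulr_sumr.
have k0 : 0 < 2 * (1 + r) / r by rewrite divr_gt0 // mulr_gt0 // addr_gt0.
(* The tail starts at $Y+1 > \sqrt x$, hence $(Y+1)^{-r} \le x^{-r/2}$; then $2 - r/2 = 1 + s/2$. *)
apply: (@le_trans _ _ (20 * x ^+ 2 * (2 * (1 + r) / r * x `^ (- r / 2)))).
  rewrite ler_pM2l ?mulr_gt0 ?exprn_gt0 //.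
  apply: le_trans (tail_powR_le _ r0 (ltn0Sn Y)) _; rewrite ler_pM2l //.
  have sx0 : 0 < Num.sqrt x by rewrite sqrtr_gt0.
  rewrite mulrC powRrM powR12_sqrt ?(ltW x0) // !powRN.
  rewrite lef_pV2 ?posrE ?powR_gt0 ?ltr0n //.
  apply: ge0_ler_powR; rewrite ?nnegrE ?(ltW r0) ?(ltW sx0) //.
  by have /andP[_ /ltW] := truncn_itv (ltW sx0).
have -> : x `^ (1 + s / 2) = x ^+ 2 * x `^ (- r / 2).
  rewrite -powR_mulrn ?(ltW x0) // -powRD; last by rewrite (gt_eqF x0) implybT.
  by congr powR; rewrite /r; field.
by rewrite le_eqVlt; apply/orP; left; apply/eqP; ring.
Unshelve. all: by end_near.
Qed.

End Asymptotics.

(** * The two ranges of $t$ *)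

Theorem corollary3 (R : realType) (t : R) (ht2 : t < 2) (ht0 : t != 0) :
  cvgn (prime_partial_prod (euler_factor t)) /\
  exists E : R -> R,
    (forall x : R, 1 < x ->
      gcd_ratio_sum t x =
        x ^+ 2 * prime_prod (euler_factor t) + E x) /\
    (0 < t -> vinogradov_gt1 E (fun x : R => x `^ (1 + t / 2) * ln x)) /\
    (t < 0 -> vinogradov_gt1 E (fun x : R => x * ln x ^+ 3)).
Proof.
have [Pcv _] := euler_product_cvg (coef1 t) (@coefM R t)
  (coef_prime_sum ht2) (coef_sum_le ht2 ht0).
split=> //.
exists (fun x => gcd_ratio_sum t x - x ^+ 2 * prime_prod (euler_factor t)).
split=> [x _|]; first by rewrite addrC subrK.
(* On $[x_0, \infty)$ with $x_0 > 1$ the constant $1$ is absorbed into $\ln x$; this is where the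
   implied constant depends on $x_0$. *)
have log_le (x0 x : R) : 1 < x0 -> x0 <= x -> 1 + ln x <= (1 + (ln x0)^-1) * ln x.
  move=> x01 x0x; have l0 : 0 < ln x0 by rewrite ln_gt0.
  rewrite mulrDl mul1r [leRHS]addrC lerD2r mulrC ler_pdivlMr // mul1r.
  by rewrite ler_ln ?posrE //; lra.
split=> [t0|t0] x0 x01.
  (* Here $s = t$ and $r = 2 - t$: the first summand comes from [sum_powR_le] for $d \le \sqrt x$,
     the second from the tail. *)
  exists ((11 * ((1 + t) / t) + 20 * (2 * (1 + (2 - t)) / (2 - t))) *
    (1 + (ln x0)^-1)) => x x0x.
  have x1 : 1 < x by lra.
  have lx : 0 < ln x by rewrite ln_gt0.
  have := gcd_ratio_sum_approx ht2 ht0 (ltW x1).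
  have -> : Num.max t 0 = t by rewrite max_l // ltW.
  move=> /le_trans; apply.
  have xE : x `^ (1 + t / 2) = x * Num.sqrt x `^ t.
    rewrite powRD ?powRr1 ?(mulrC t) ?powRrM ?powR12_sqrt //; lra.
  have x0' : 0 < x by lra.
  have sx0 : 0 < Num.sqrt x by rewrite sqrtr_gt0.
  have A : \sum_(1 <= d < (Num.truncn (Num.sqrt x)).+1) d%:R `^ (t - 1) <=
      (1 + t) / t * Num.sqrt x `^ t.
    apply: le_trans (sum_powR_le _ t0) _.
    rewrite ler_wpM2l ?divr_ge0 ?addr_ge0 ?(ltW t0) //.
    apply: ge0_ler_powR; rewrite ?nnegrE ?(ltW t0) ?(ltW sx0) //.
    by have /andP[] := truncn_itv (ltW sx0).
  have z0 : 0 < x `^ (1 + t / 2) by exact: powR_gt0.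
  have k0 : 0 < 2 * (1 + (2 - t)) / (2 - t) by rewrite divr_gt0; lra.
  have k1 : 0 < (1 + t) / t by rewrite divr_gt0; lra.
  move: A z0 k0 k1 (log_le _ _ x01 x0x).
  set k := 2 * (1 + (2 - t)) / (2 - t); set l := (1 + t) / t.
  set L := 1 + (ln x0)^-1; set S := \sum_(1 <= d < _) _; rewrite xE.
  move: (Num.sqrt x `^ t : R) => q A z0 k0 l0 uL.
  apply: (@le_trans _ _ ((11 * l + 20 * k) * ((1 + ln x) * (x * q)))).
    have -> : (11 * l + 20 * k) * ((1 + ln x) * (x * q)) =
        11 * x * (1 + ln x) * (l * q) + 20 * k * (x * q) * (1 + ln x) by ring.
    apply: lerD; first by rewrite ler_wpM2l // !mulr_ge0 // ?addr_ge0 // ltW.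
    rewrite ler_peMr ?lerDl ?(ltW lx) // mulr_ge0 ?(ltW z0) // mulr_ge0 //.
    exact: ltW.
  have lk0 : 0 < 11 * l + 20 * k.
    by apply: addr_gt0; apply: mulr_gt0.
  rewrite -[leRHS]mulrA (ler_pM2l lk0).
  by rewrite [leRHS]mulrCA [leLHS]mulrC ler_pM2l.
(* Here $s = 0$ and $r = 2$: the tail contributes $20 \cdot 2 \cdot 3/2 = 60$ and the small $d$
   contribute $11$. *)
exists (71 * (1 + (ln x0)^-1) ^+ 3) => x x0x.
have x1 : 1 < x by lra.
have x0' : 0 < x by lra.
have lx : 0 < ln x by rewrite ln_gt0.
have sx0 : 0 < Num.sqrt x by rewrite sqrtr_gt0.
have := gcd_ratio_sum_approx ht2 ht0 (ltW x1).
have -> : Num.max t 0 = 0 by rewrite max_r // ltW.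
move=> /le_trans; apply; rewrite mul0r addr0 powRr1 ?(ltW x0') //.
have sx1 : 1 <= Num.sqrt x by rewrite -sqrtr1 ler_sqrt // ltW.
(* With $s = 0$ the sum over small $d$ is harmonic. *)
have A : \sum_(1 <= d < (Num.truncn (Num.sqrt x)).+1) d%:R `^ (0 - 1) <= 1 + ln x.
  under eq_bigr do rewrite sub0r powR_inv1 ?ler0n //.
  have Y0 : (0 < Num.truncn (Num.sqrt x))%N by rewrite truncn_gt0.
  apply: le_trans (harmonic_sum_le Y0) _.
  rewrite lerD2l ler_ln ?posrE ?ltr0n //.
  have /andP[/le_trans + _] := truncn_itv (ltW sx0); apply.
  by rewrite -[leRHS]sqr_sqrtr ?(ltW x0') // expr2 ler_peMl // ltW.
have uL := log_le _ _ x01 x0x.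
move: A uL; set S := \sum_(1 <= d < _) _; set L := 1 + (ln x0)^-1 => A uL.
have u1 : 1 <= 1 + ln x by rewrite lerDl ltW.
(* The two contributions are $O(x(1+\ln x)^2)$ and $O(x)$; both are raised to the third power of $1
   + \ln x \ge 1$. *)
apply: (@le_trans _ _ (71 * (x * (1 + ln x) ^+ 3))).
  move: (1 + ln x) u1 A => u u1 A.
  have u2 : 1 <= u ^+ 2 by rewrite exprn_ege1.
  have u3 : u ^+ 2 <= u ^+ 3 by rewrite ler_weXn2l.
  have h1 : 11 * x * u * S <= 11 * (x * u ^+ 3).
    apply: (@le_trans _ _ (11 * x * u * u)).
      by apply: ler_wpM2l => //; apply: mulr_ge0; [apply: mulr_ge0|]; lra.
    by rewrite -!mulrA ler_pM2l // ler_pM2l // -expr2.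
  have h2 : 20 * (2 * (1 + (2 - 0)) / (2 - 0)) * x <= 60 * (x * u ^+ 3).
    rewrite subr0; have -> : 20 * (2 * (1 + 2) / 2) * x = 60 * x :> R by field.
    by rewrite ler_pM2l // ler_peMr ?(ltW x0') //; lra.
  lra.
have -> : 71 * L ^+ 3 * (x * ln x ^+ 3) = 71 * (x * (L * ln x) ^+ 3) by ring.
by rewrite ler_pM2l // ler_pM2l // lerXn2r ?nnegrE //; lra.
Qed.
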